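(* Let $a, b, k_1, k_2 \in \mathbb{R}_{>0}$, let $Z$ be a real random variable with density $f_Z(z) = \frac{1}{2ab\Gamma(a)} \exp\left(-\left|\frac{z}{b}\right|^{\frac1a}\right)$, and let $L(z) = k_1 z$ for $z \ge 0$ and $L(z) = -k_2 z$ for $z < 0$. Then for any $c \in \mathbb{R}$ the expected value and the variance of $L(Z+c)$ are \begin{align*} (1)\quad \mathrm{E}[L(Z+c)] &= \frac{(k_1-k_2)c}{2} + \frac{(k_1+k_2)|c|}{2\Gamma(a)} \gamma\left(a, \left|\frac{c}{b}\right|^{\frac1a}\right) + \frac{(k_1+k_2)b}{2\Gamma(a)} \Gamma\left(2a, \left|\frac{c}{b}\right|^{\frac1a}\right), \\ (2)\quad \mathrm{V}[L(Z+c)] &= \frac{(k_1+k_2)^2c^2}{4} + \frac{(k_1^2-k_2^2)bc}{2\Gamma(a)} \Gamma\left(2a, \left|\frac{c}{b}\right|^{\frac1a}\right) \\ &\quad - \frac{(k_1+k_2)^2 b|c|}{2\Gamma(a)^2} \gamma\left(a, \left|\frac{c}{b}\right|^{\frac1a}\right)\Gamma\left(2a, \left|\frac{c}{b}\right|^{\frac1a}\right) \\ &\quad - \frac{(k_1+k_2)^2c^2}{4\Gamma(a)^2}\gamma\left(a, \left|\frac{c}{b}\right|^{\frac1a}\right)^2 - \frac{(k_1+k_2)^2b^2}{4\Gamma(a)^2}\Gamma\left(2a, \left|\frac{c}{b}\right|^{\frac1a}\right)^2 \\ &\quad + \frac{(k_1^2+k_2^2)b^2\Gamma(3a)}{2\Gamma(a)}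 + \mathrm{Sgn}(c)\frac{(k_1^2-k_2^2)b^2}{2\Gamma(a)}\gamma\left(3a, \left|\frac{c}{b}\right|^{\frac1a}\right). \end{align*}
   Context: For $a>0$ and $x \ge 0$: $\Gamma(a) = \int_0^{+\infty} t^{a-1}e^{-t}\,dt$ is the gamma function, $\Gamma(a,x) = \int_x^{+\infty} t^{a-1}e^{-t}\,dt$ is the upper incomplete gamma function, and $\gamma(a,x) = \int_0^x t^{a-1}e^{-t}\,dt$ is the lower incomplete gamma function. For $c \in \mathbb{R}$, $\mathrm{Sgn}(c) = 1$ if $c \ge 0$ and $\mathrm{Sgn}(c) = -1$ if $c<0$. $\mathrm{E}$ and $\mathrm{V}$ denote expected value and variance. *)

(* Defs.v *)
From mathcomp Require Import all_boot all_order all_algebra.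
From mathcomp Require Import all_classical all_reals all_analysis.

Import Order.TTheory GRing.Theory Num.Theory.
Import numFieldNormedType.Exports.

Local Open Scope classical_set_scope.
Local Open Scope ring_scope.

(* [Rintegral] is real-valued; for [0 < a] and [0 <= x], the only range in
   which these three functions are used, the integrals are finite, so no
   information is lost. The value of [t `^ (a - 1)] at [t = 0] (where the
   integrand may be infinite) is irrelevant: [0] is a null point. *)
Definition Gamma {R : realType} (a : R) : R :=
  \int[lebesgue_measure]_(t in `[0, +oo[) (t `^ (a - 1) * expR (- t)).

Definition upper_gamma {R : realType} (a x : R) : R :=
  \int[lebesgue_measure]_(t in `[x, +oo[) (t `^ (a - 1) * expR (- t)).

Definition lower_gamma {R : realType} (a x : R) : R :=
  \int[lebesgue_measure]_(t in `[0, x]) (t `^ (a - 1) * expR (- t)).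

(* Unlike [Num.sg], this sign is 1 at 0. *)
Definition Sgn {R : realType} (c : R) : R := if 0 <= c then 1 else - 1.

Definition has_density {d : measure_display} {T : measurableType d}
    {R : realType} (P : probability T R) (X : {RV P >-> R}) (f : R -> R) : Prop :=
  [/\ measurable_fun [set: R] f,
      (forall x, 0 <= f x) &
      forall A : set R, measurable A ->
        distribution P X A = (\int[lebesgue_measure]_(x in A) (f x)%:E)%E].

Definition fZ {R : realType} (a b z : R) : R :=
  (2 * a * b * Gamma a)^-1 * expR (- (`|z / b| `^ (a^-1))).

Definition L {R : realType} (k1 k2 z : R) : R :=
  if 0 <= z then k1 * z else - k2 * z.

(* Main.v *)
Require Import Defs.
From mathcomp Require Import all_boot all_order all_algebra.
From mathcomp Require Import all_classical all_reals all_analysis.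
From mathcomp Require Import measurable_realfun ring lra.

Import Order.TTheory GRing.Theory Num.Theory.
Import numFieldNormedType.Exports.

Local Open Scope classical_set_scope.
Local Open Scope ring_scope.

(** Since the density [fZ] is even, the expectation of [h Z] for [h >= 0] is the
    integral over [z > 0] of [(h z + h (- z)) * fZ z].  For [h z = L (z + c)]
    and for its square, the symmetrised function [h z + h (- z)] is a polynomial
    in [z] of degree at most two on each of two pieces: [z <= `|c|], where
    [c + z] and [c - z] lie on the same side of [0] as [c], and [z > `|c|],
    where [c + z > 0 > c - z] (lemmas [L_reflect_near], [L_reflect_far] and
    their squared versions).  Everything is thereby reduced to the moments of
    [fZ] truncated at [`|c|].

    The substitution [z = b * t ^ a] turns [z ^ k * fZ z dz] into
    [b ^ k / (2 * Gamma a) * t ^ ((k + 1) * a - 1) * exp (- t) dt] and the cut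
    [z = `|c|] into [t = x], where [x = `|c / b| ^ (1 / a)].  The truncated
    moments are therefore lower and upper incomplete gamma values at [a],
    [2 * a] and [3 * a] (lemmas [integral_moment_head] and
    [integral_moment_tail]), and [integral_piecewise_quadratic] combines them.

    The variance is the second moment minus the square of the first.  The values
    [upper_gamma a x] and [upper_gamma (3 * a) x] disappear from the formulas
    through [upper_gamma p x = Gamma p - lower_gamma p x], which needs the Gamma
    integral to converge (lemma [integrable_gamma_integrand]). *)

(** * Expectations from densities *)

Lemma ge0_integrable_EFin {d : measure_display} {T : measurableType d}
    {R : realType} (mu : {measure set T -> \bar R}) (D : set T) (X : T -> R)
    (r : R) : measurable_fun D X -> (forall w, D w -> 0 <= X w) ->
  (\int[mu]_(w in D) (X w)%:E = r%:E)%E -> mu.-integrable D (EFin \o X).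
Proof.
move=> mX X0 Xr; apply/integrableP; split; first exact/measurable_EFinP.
have -> : (\int[mu]_(w in D) `|(EFin \o X) w| = \int[mu]_(w in D) (X w)%:E)%E.
  by apply: eq_integral => w; rewrite inE => Dw; rewrite /= ger0_norm// X0.
by rewrite Xr ltry.
Qed.

(** The density is a Radon-Nikodym derivative of the law of [X], hence equal
    almost everywhere to the derivative for which the change of variables
    formula is available. *)
Lemma ge0_integral_density {d : measure_display} {T : measurableType d}
    {R : realType} {P : probability T R} {X : {RV P >-> R}} {f : R -> R}
    (g : R -> R) : has_density P X f -> measurable_fun [set: R] g ->
  (forall x, 0 <= g x) ->
  (\int[P]_w (g (X w))%:E = \int[lebesgue_measure]_x (g x * f x)%:E)%E.
Proof.
move=> [mf f0 fE] mg g0.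
have mEf : measurable_fun [set: measurableTypeR R] (EFin \o f).
  exact/measurable_EFinP.
have mEg : measurable_fun [set: measurableTypeR R] (EFin \o g).
  exact/measurable_EFinP.
(* The Lebesgue measure lives on the sigma-algebra generated by half-open
   intervals.  It has the same measurable sets as the Borel structure carried
   by [R] itself, but [X] has to be retyped before its law and the Lebesgue
   measure can be compared. *)
have mX : measurable_fun [set: T] (X : T -> measurableTypeR R).
  exact: (measurable_funPT X).
pose X' : {RV P >-> measurableTypeR R} :=
  @mfun_Sub _ _ T (measurableTypeR R) X (mem_set mX).
pose mu : {sigma_finite_measure set measurableTypeR R -> \bar R} :=
  lebesgue_measure.
pose nu : {finite_measure set measurableTypeR R -> \bar R} :=
  distribution P X'.
have nuE A : measurable A -> nu A = (\int[mu]_(x in A) (f x)%:E)%E.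
  exact: fE.
have dom : nu `<< mu.
  apply/null_content_dominatesP => A mA A0.
  by rewrite nuE// null_set_integral//; exact: measurable_funTS.
transitivity (\int[nu]_x (EFin \o g) x)%E.
  by rewrite (ge0_integral_distribution X' mEg).
have RNf := Radon_Nikodym_SigmaFinite.f_integrable dom.
rewrite -(Radon_Nikodym_SigmaFinite.change_of_variables dom)//.
apply: ae_eq_integral => //.
- by apply: emeasurable_funM => //; exact: measurable_int RNf.
- by apply/measurable_EFinP; exact: measurable_funM.
rewrite (_ : (fun x => (g x * f x)%:E) = (EFin \o g) \* (EFin \o f))%E//.
apply: ae_eqe_mul2l => /=.
apply: integral_ae_eq => // A _ mA.
by rewrite -Radon_Nikodym_SigmaFinite.f_integral// nuE.
Qed.

(** * The substitution z = b * t ^ a *)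

Lemma continuous_powR {R : realType} (p t : R) :
  0 < t -> {for t, continuous (@powR R ^~ p)}.
Proof.
move=> t0; apply/differentiable_continuous/derivable1_diffP.
by apply: derivable_powR; rewrite in_itv/= t0.
Qed.

Definition power_map {R : realType} (a b t : R) : R := b * t `^ a.

Definition dpower_map {R : realType} (a b t : R) : R :=
  b * (a * t `^ (a - 1)).

Section power_substitution.
Context {R : realType}.
Variables (a b : R).
Hypotheses (a_gt0 : 0 < a) (b_gt0 : 0 < b).
Notation mu := (@lebesgue_measure R).

Local Notation F := (power_map a b).
Local Notation F' := (dpower_map a b).

Let is_derive_F (t : R) : 0 < t -> is_derive t 1 F (F' t).
Proof. by move=> t0; exact: (is_deriveZ b (is_derive1_powR a t0)). Qed.

Let continuous_F (t : R) : 0 < t -> {for t, continuous F}.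
Proof.
move=> t0; apply: continuousM; first exact: cst_continuous.
exact: continuous_powR.
Qed.

Let continuous_F' (t : R) : 0 < t -> {for t, continuous F'}.
Proof.
move=> t0; apply: continuousM; first exact: cst_continuous.
by apply: continuousM; [exact: cst_continuous|exact: continuous_powR].
Qed.

Let derive_F (t : R) : 0 < t -> F^`()%classic t = F' t.
Proof.
move=> t0; rewrite derive1E.
by rewrite (@derive_val _ _ _ _ _ _ _ (is_derive_F _ t0)).
Qed.

Let F_gt0 t : 0 < t -> 0 < F t.
Proof. by move=> t0; rewrite mulr_gt0// powR_gt0. Qed.

Let F_lt (s t : R) : 0 <= s -> s < t -> F s < F t.
Proof.
move=> s0 st; rewrite ltr_pM2l// gt0_ltr_powR// nnegrE ltW//.
exact: le_lt_trans st.
Qed.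

Let cvg_F' (t : R) : 0 < t -> F^`()%classic @ t --> F' t.
Proof.
move=> t0; apply: cvg_trans (continuous_F' _ t0).
apply: near_eq_cvg; near=> s; rewrite derive_F//.
by near: s; exact: lt_nbhsr.
Unshelve. all: by end_near. Qed.

Lemma ge0_integral_power_map_itvcc (G : R -> R) (u v : R) : 0 < u -> u <= v ->
  {in `]0, +oo[, continuous G} ->
  (\int[mu]_(z in `[F u, F v]) (G z)%:E =
   \int[mu]_(t in `[u, v]) (G (F t) * F' t)%:E)%E.
Proof.
move=> u0 uv cG.
have pos t : u <= t -> 0 < t by exact: lt_le_trans.
rewrite integration_by_substitution_increasing//.
- apply: eq_integral => t; rewrite inE/= in_itv/= => /andP[ut _].
  by rewrite !fctE derive_F// pos.
- move=> s t; rewrite !in_itv/= => /andP[us _] _ st.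
  by rewrite F_lt// ltW// pos.
- move=> t; rewrite in_itv/= => /andP[ut _].
  have t0 := pos _ (ltW ut).
  by rewrite /continuous_at derive_F//; exact: cvg_F'.
- by apply/cvg_ex; exists (F' u); apply: cvg_at_right_filter; exact: cvg_F'.
- apply/cvg_ex; exists (F' v); apply: cvg_at_left_filter; apply: cvg_F'.
  exact: pos.
- split.
  + move=> t; rewrite in_itv/= => /andP[ut _].
    by have [] := is_derive_F _ (pos _ (ltW ut)).
  + by apply: cvg_at_right_filter; exact: continuous_F.
  + by apply: cvg_at_left_filter; apply: continuous_F; exact: pos.
- apply: continuous_in_subspaceT => z; rewrite inE/= in_itv/= => /andP[uz _].
  by apply: cG; rewrite in_itv/= andbT (lt_le_trans _ uz)// F_gt0.
Qed.

(** The compact case does not extend directly to [`]0, x]] or [`]x, +oo[]: the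
    derivative of [t ^ a] is unbounded near [0] when [a < 1] and near infinity
    when [1 < a].  Exhausting the domain by compact intervals of positive reals
    and passing to the limit by monotone convergence avoids any condition on
    the derivative at the ends. *)
Lemma ge0_integral_power_map_bigcup (G : R -> R) (u v : nat -> R) :
  nonincreasing_seq u -> nondecreasing_seq v ->
  (forall n, 0 < u n) -> (forall n, u n <= v n) ->
  {in `]0, +oo[, continuous G} -> (forall z, 0 < z -> 0 <= G z) ->
  (\int[mu]_(z in \bigcup_n `[F (u n), F (v n)]%classic) (G z)%:E =
   \int[mu]_(t in \bigcup_n `[u n, v n]%classic) (G (F t) * F' t)%:E)%E.
Proof.
move=> du dv u0 uv cG G0.
have F_le s t : 0 < s -> s <= t -> F s <= F t.
  by move=> s0; rewrite le_eqVlt => /predU1P[->//|/F_lt/ltW]; apply; exact: ltW.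
have pos n t : u n <= t -> 0 < t by exact: lt_le_trans.
have cvgR : (\int[mu]_(t in `[u n, v n]) (G (F t) * F' t)%:E @[n --> \oo] -->
    \int[mu]_(t in \bigcup_n `[u n, v n]%classic) (G (F t) * F' t)%:E)%E.
  apply: ge0_nondecreasing_set_cvg_integral => //.
  - move=> m n mn; apply/subsetPset => t /=; rewrite !in_itv/= => /andP[ut tv].
    by rewrite (le_trans (du _ _ mn))//= (le_trans tv)// dv.
  - move=> n; apply/measurable_EFinP.
    apply: subspace_continuous_measurable_fun => //.
    apply: continuous_in_subspaceT => t; rewrite inE/= in_itv/= => /andP[ut _].
    have t0 := pos _ _ ut.
    apply: continuousM; last exact: continuous_F'.
    apply: continuous_comp; first exact: continuous_F.
    by apply: cG; rewrite in_itv/= andbT F_gt0.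
  - move=> n t; rewrite /= in_itv/= => /andP[/pos t0 _].
    by rewrite lee_fin mulr_ge0 ?G0 ?F_gt0// !mulr_ge0 ?powR_ge0 ?ltW.
have cvgL : (\int[mu]_(z in `[F (u n), F (v n)]) (G z)%:E @[n --> \oo] -->
    \int[mu]_(z in \bigcup_n `[F (u n), F (v n)]%classic) (G z)%:E)%E.
  have posF n z : F (u n) <= z -> 0 < z by apply: lt_le_trans; exact: F_gt0.
  apply: ge0_nondecreasing_set_cvg_integral => //.
  - move=> m n mn; apply/subsetPset => t /=; rewrite !in_itv/= => /andP[ut tv].
    rewrite (le_trans (F_le _ _ (u0 _) (du _ _ mn)))//= (le_trans tv)// F_le//.
    + exact: lt_le_trans (uv _).
    + exact: dv.
  - move=> n; apply/measurable_EFinP.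
    apply: subspace_continuous_measurable_fun => //.
    apply: continuous_in_subspaceT => z; rewrite inE/= in_itv/= => /andP[uz _].
    by apply: cG; rewrite in_itv/= andbT (posF n).
  - by move=> n t; rewrite /= in_itv/= => /andP[/posF t0 _]; rewrite lee_fin G0.
move: cvgL; under eq_fun do rewrite ge0_integral_power_map_itvcc//.
by move/cvg_unique; exact.
Qed.

Let F_onto (z : R) : 0 < z -> exists2 t, 0 < t & F t = z.
Proof.
move=> z0; exists ((z / b) `^ a^-1); first by rewrite powR_gt0// divr_gt0.
rewrite /power_map -powRrM mulVf ?gt_eqF// powRr1 ?divr_ge0 ?ltW//.
by rewrite mulrC divfK ?gt_eqF.
Qed.

Let F_ltE (s t : R) : 0 <= s -> 0 <= t -> (F s < F t) = (s < t).
Proof.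
move=> s0 t0; apply/idP/idP => [|]; last exact: F_lt.
apply: contraTT; rewrite -!leNgt le_eqVlt => /predU1P[->//|/F_lt/ltW]; exact.
Qed.

Let bigcup_F (u v : nat -> R) : (forall n, 0 < u n) -> (forall n, u n <= v n) ->
  \bigcup_n `[F (u n), F (v n)]%classic = F @` \bigcup_n `[u n, v n]%classic.
Proof.
move=> u0 uv; apply/seteqP; split=> [z [n _]|_ [t [n _]] + <-]; last first.
  rewrite /= in_itv/= => /andP[unt tvn]; exists n => //=.
  have t0 := lt_le_trans (u0 n) unt; have v0 := lt_le_trans t0 tvn.
  by rewrite in_itv/= !leNgt !F_ltE ?ltW// -!leNgt unt tvn.
rewrite /= in_itv/= => /andP[uz zv].
have /F_onto[t t0 tz] := lt_le_trans (F_gt0 _ (u0 n)) uz.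
exists t => //; exists n => //=; rewrite in_itv/=.
have v0 := lt_le_trans (u0 n) (uv n).
by move: uz zv; rewrite -tz !leNgt !F_ltE ?ltW// => -> ->.
Qed.

Lemma ge0_integral_power_map_head (G : R -> R) (x : R) : 0 <= x ->
  {in `]0, +oo[, continuous G} -> (forall z, 0 < z -> 0 <= G z) ->
  (\int[mu]_(z in `]0%R, F x]) (G z)%:E =
   \int[mu]_(t in `]0%R, x]) (G (F t) * F' t)%:E)%E.
Proof.
rewrite le_eqVlt => /predU1P[<- _ _|x0 cG G0].
  rewrite /power_map powR0 ?gt_eqF// mulr0.
  by rewrite !set_itv_ge ?bnd_simp ?ltxx// !integral_set0.
pose u n : R := x / n.+1%:R; pose v (n : nat) := x.
have u0 n : 0 < u n by rewrite divr_gt0.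
have uv n : u n <= v n by rewrite ler_pdivrMr// ler_peMr ?ler1n// ltW.
have uvE : \bigcup_n `[u n, v n]%classic = `]0, x]%classic.
  apply/seteqP; split=> t; rewrite /= in_itv/=.
    by move=> [n _] /=; rewrite in_itv/= => /andP[/(lt_le_trans (u0 n))->].
  move=> /andP[t0 tx]; exists (Num.truncn (x / t)) => //=.
  rewrite in_itv/= tx andbT.
  by rewrite ler_pdivrMr// mulrC -ler_pdivrMr// ltW// truncnS_gt.
have FE : \bigcup_n `[F (u n), F (v n)]%classic = `]0, F x]%classic.
  rewrite bigcup_F// uvE; apply/seteqP; split=> [_ [t] + <-|z] /=.
    rewrite !in_itv/= => /andP[t0 tx].
    by rewrite F_gt0//= leNgt F_ltE ?ltW// -leNgt.
  rewrite in_itv/= => /andP[/F_onto[t t0 <-]].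
  rewrite leNgt F_ltE ?ltW// -leNgt => tx.
  by exists t; rewrite //= in_itv/= t0.
rewrite -FE -uvE ge0_integral_power_map_bigcup//.
by move=> m n mn; rewrite ler_pM2l// lef_pV2 ?posrE// ler_nat.
Qed.

Lemma ge0_integral_power_map_tail (G : R -> R) (x : R) : 0 <= x ->
  {in `]0, +oo[, continuous G} -> (forall z, 0 < z -> 0 <= G z) ->
  (\int[mu]_(z in `]F x, +oo[) (G z)%:E =
   \int[mu]_(t in `]x, +oo[) (G (F t) * F' t)%:E)%E.
Proof.
move=> x0 cG G0.
pose u n : R := x + n.+1%:R^-1; pose v n : R := x + n.+1%:R.
have u0 n : 0 < u n by rewrite ltr_wpDl.
have uv n : u n <= v n.
  by rewrite lerD2l (@le_trans _ _ 1) ?ler1n// invf_le1// ler1n.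
have uvE : \bigcup_n `[u n, v n]%classic = `]x, +oo[%classic.
  apply/seteqP; split=> t; rewrite /= in_itv/= andbT.
    move=> [n _] /=; rewrite in_itv/= => /andP[+ _].
    by apply: lt_le_trans; rewrite ltrDl.
  rewrite -subr_gt0 => xt.
  exists (maxn (Num.truncn (t - x)^-1) (Num.truncn (t - x))) => //=.
  rewrite in_itv/=; apply/andP; split.
    rewrite -lerBrDl invf_ple ?posrE// ltW// (lt_le_trans (truncnS_gt _))//.
    by rewrite ler_nat ltnS leq_maxl.
  rewrite -lerBlDl ltW// (lt_le_trans (truncnS_gt _))//.
  by rewrite ler_nat ltnS leq_maxr.
have FE : \bigcup_n `[F (u n), F (v n)]%classic = `]F x, +oo[%classic.
  rewrite bigcup_F// uvE; apply/seteqP; split=> [_ [t] + <-|z] /=.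
    by move=> xt; rewrite in_itv/= andbT F_lt// (itvP xt).
  rewrite in_itv/= andbT => Fz.
  have Fx0 : 0 <= F x by rewrite mulr_ge0 ?powR_ge0// ltW.
  have /F_onto[t t0 tz] := le_lt_trans Fx0 Fz.
  by exists t; rewrite //= in_itv/= andbT -(F_ltE _ _ x0 (ltW t0)) tz.
rewrite -FE -uvE ge0_integral_power_map_bigcup//.
- by move=> m n mn; rewrite lerD2l lef_pV2 ?posrE// ler_nat.
- by move=> m n mn; rewrite lerD2l ler_nat.
Qed.

End power_substitution.

(** * Convergence of the Gamma integral *)

Definition gamma_integrand {R : realType} (p t : R) : R :=
  t `^ (p - 1) * expR (- t).

Section gamma_integrand.
Context {R : realType}.
Notation mu := (@lebesgue_measure R).

Lemma gamma_integrand_ge0 (p t : R) : 0 <= gamma_integrand p t.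
Proof. by rewrite mulr_ge0 ?powR_ge0 ?expR_ge0. Qed.

Lemma measurable_gamma_integrand (p : R) (D : set R) :
  measurable_fun D (gamma_integrand p).
Proof.
apply: measurable_funTS; apply: measurable_funM => //.
by apply: measurableT_comp => //; exact: measurable_funN.
Qed.

(** A power is dominated by the term of the next integer degree in the power
    series of [expR (t / 2)]; half of the decay of [expR (- t)] remains. *)
Lemma le_powR_expR (p t : R) : 1 <= t ->
  t `^ p <= 2 ^+ (Num.truncn p).+1 * (Num.truncn p).+1`!%:R * expR (2^-1 * t).
Proof.
move=> t1; set N := (Num.truncn p).+1.
apply: (@le_trans _ _ (t ^+ N)).
  by rewrite -powR_mulrn ?(le_trans ler01)// ler_powR// ltW// truncnS_gt.
have t0 : 0 <= 2^-1 * t by rewrite mulr_ge0// (le_trans ler01).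
have := expR_ge1Dxn (Num.truncn p) t0; rewrite -/N => /(le_trans _) le1.
have {le1} : (2^-1 * t) ^+ N / N`!%:R <= expR (2^-1 * t).
  by apply: le1; rewrite lerDr.
rewrite ler_pdivrMr ?ltr0n ?fact_gt0// exprMn exprVn mulrC.
rewrite ler_pdivrMr ?exprn_gt0// => /le_trans; apply.
by rewrite le_eqVlt; apply/orP; left; apply/eqP; ring.
Qed.

(** The singular factor [t ^ (p - 1)] is the derivative of [t ^ p / p], so its
    integral near [0] is a length after substitution. *)
Lemma integral_gamma_integrand_head (p : R) : 0 < p ->
  (\int[mu]_(t in `]0%R, 1%R]) (gamma_integrand p t)%:E < +oo)%E.
Proof.
move=> p0.
have p0' : 0 < p^-1 by rewrite invr_gt0.
apply: (@le_lt_trans _ _ (\int[mu]_(t in `]0%R, 1%R])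
    (1 * dpower_map p p^-1 t)%:E)%E).
  apply: ge0_le_integral => //.
  - by move=> t _; rewrite lee_fin gamma_integrand_ge0.
  - apply/measurable_EFinP; exact: measurable_gamma_integrand.
  - rewrite /dpower_map; apply/measurable_EFinP.
    do 3 apply: measurable_funM => //.
    by apply: measurable_funTS; exact: measurable_powR.
  - move=> t; rewrite /= in_itv/= => /andP[t0 _].
    rewrite lee_fin /dpower_map mul1r mulrA mulVf ?gt_eqF// mul1r.
    by rewrite ler_piMr ?powR_ge0// -expR0 ler_expR oppr_le0 ltW.
rewrite -(@ge0_integral_power_map_head _ p p^-1 p0 p0' (fun=> 1))//.
  rewrite integral_cst//= mul1e lebesgue_measure_itv/=.
  by case: ifP => _; rewrite ltry.
by move=> z _; exact: cst_continuous.
Qed.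

(** The integrand is dominated by a multiple of the exponential density of rate
    [1 / 2]. *)
Lemma integral_gamma_integrand_tail (p : R) :
  (\int[mu]_(t in `]1%R, +oo[) (gamma_integrand p t)%:E < +oo)%E.
Proof.
pose N := (Num.truncn (p - 1)).+1.
(* The factor [2] cancels the normalisation of the exponential density. *)
pose C : R := 2 * (2 ^+ N * N`!%:R).
apply: (@le_lt_trans _ _ (\int[mu]_t (C%:E * (exponential_pdf 2^-1 t)%:E))%E).
  rewrite [leLHS]integral_mkcond; apply: ge0_le_integral => //.
  - move=> t _; apply: erestrict_ge0 => s _.
    by rewrite lee_fin gamma_integrand_ge0.
  - apply/(measurable_restrictT (fun t => (gamma_integrand p t)%:E)) => //.
    apply/measurable_EFinP; exact: measurable_gamma_integrand.
  - apply/measurable_EFinP; apply: measurable_funM => //.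
    exact: measurable_exponential_pdf.
  - move=> t _; rewrite patchE; case: ifPn => [|_]; last first.
      rewrite lee_fin mulr_ge0 ?exponential_pdf_ge0//.
      by rewrite !mulr_ge0.
    rewrite inE/= in_itv/= andbT => t1.
    rewrite exponential_pdfE ?lee_fin; last by rewrite (le_trans _ (ltW t1)).
    rewrite /gamma_integrand.
    have -> : expR (- t) = expR (- 2^-1 * t) * expR (- 2^-1 * t).
      by rewrite -expRD; congr expR; lra.
    apply: (@le_trans _ _ (C / 2 * expR (2^-1 * t) *
        (expR (- 2^-1 * t) * expR (- 2^-1 * t)))).
      rewrite ler_wpM2r ?mulr_ge0 ?expR_ge0//.
      rewrite (le_trans (le_powR_expR _ _ (ltW t1)))// ler_wpM2r ?expR_ge0//.
      by rewrite /C [2 * _]mulrC mulfK.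
    rewrite le_eqVlt; apply/orP; left; apply/eqP.
    rewrite mulNr expRN; field.
    by rewrite gt_eqF ?expR_gt0.
rewrite ge0_integralZl//.
- by rewrite integral_exponential_pdf// mule1 ltry.
- by apply/measurable_EFinP; exact: measurable_exponential_pdf.
- by move=> t _; rewrite lee_fin exponential_pdf_ge0.
- by rewrite lee_fin !mulr_ge0.
Qed.

Lemma integrable_gamma_integrand (p : R) : 0 < p ->
  mu.-integrable `]0%R, +oo[ (fun t => (gamma_integrand p t)%:E).
Proof.
move=> p0; apply/integrableP; split.
  apply/measurable_EFinP; exact: measurable_gamma_integrand.
under eq_integral do rewrite /= ger0_norm ?gamma_integrand_ge0//.
have -> : `]0%R, +oo[%classic = `]0%R, 1%R] `|` `]1%R, +oo[%classic :> set R.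
  by rewrite -itv_bndbnd_setU// bnd_simp.
rewrite ge0_integral_setU//=.
- rewrite lte_add_pinfty// ?integral_gamma_integrand_head//.
  exact: integral_gamma_integrand_tail.
- apply/measurable_EFinP; exact: measurable_gamma_integrand.
- by move=> t _; rewrite lee_fin gamma_integrand_ge0.
- apply/disj_setPS => t /=; rewrite !in_itv/= !andbT => -[/andP[_ t1]].
  by rewrite ltNge t1.
Qed.

End gamma_integrand.

(** * Incomplete gamma functions *)

Section incomplete_gamma.
Context {R : realType}.
Notation mu := (@lebesgue_measure R).

Lemma Gamma_itvoy (p : R) :
  Gamma p = \int[mu]_(t in `]0, +oo[) gamma_integrand p t.
Proof.
rewrite /Gamma /Rintegral -integral_itv_obnd_cbnd//.
by apply/measurable_EFinP; exact: (measurable_gamma_integrand p).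
Qed.

Lemma upper_gamma_itvoy (p x : R) :
  upper_gamma p x = \int[mu]_(t in `]x, +oo[) gamma_integrand p t.
Proof.
rewrite /upper_gamma /Rintegral -integral_itv_obnd_cbnd//.
by apply/measurable_EFinP; exact: (measurable_gamma_integrand p).
Qed.

Lemma lower_gamma_itvoc (p x : R) :
  lower_gamma p x = \int[mu]_(t in `]0, x]) gamma_integrand p t.
Proof.
rewrite /lower_gamma /Rintegral -integral_itv_obnd_cbnd//.
by apply/measurable_EFinP; exact: (measurable_gamma_integrand p).
Qed.

Lemma upper_gammaE (p x : R) : 0 < p -> 0 <= x ->
  upper_gamma p x = Gamma p - lower_gamma p x.
Proof.
move=> p0 x0; rewrite lower_gamma_itvoc upper_gamma_itvoy Gamma_itvoy.
have E : `]0, +oo[%classic = `]0, x] `|` `]x, +oo[%classic :> set R.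
  by rewrite -itv_bndbnd_setU// bnd_simp.
rewrite E Rintegral_setU//; first by rewrite addrAC subrr add0r.
- by rewrite -E; exact: integrable_gamma_integrand.
- apply/disj_setPS => t /=; rewrite !in_itv/= !andbT => -[/andP[_ t1]].
  by rewrite ltNge t1.
Qed.

(** A nonnegative function with zero integral vanishes almost everywhere, while
    the integrand is positive on [`]0, 1]], a set of measure [1]. *)
Lemma Gamma_gt0 (p : R) : 0 < p -> 0 < Gamma p.
Proof.
move=> p0; rewrite lt_neqAle Gamma_itvoy Rintegral_ge0 ?andbT; last first.
  by move=> t _; exact: gamma_integrand_ge0.
apply/eqP => G0.
have iG := integrable_gamma_integrand p p0.
have {}G0 : (\int[mu]_(t in `]0%R, +oo[) `|(gamma_integrand p t)%:E| = 0)%E.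
  under eq_integral do rewrite /= ger0_norm ?gamma_integrand_ge0//.
  by rewrite -[LHS]fineK ?integrable_fin_num//; congr EFin.
have /(ae_eq_integral_abs mu) : measurable (`]0, +oo[%classic : set R) by [].
move=> /(_ _ (measurable_int _ iG))[/(_ G0) + _] => -[N [mN N0 DN]].
have : (mu `]0%R, 1%R]%classic <= mu N)%E.
  apply: le_measure; rewrite ?inE// => t /=; rewrite in_itv/= => /andP[t0 _].
  apply: DN => /= /(_ _)/eqP; rewrite in_itv/= t0 => /(_ isT).
  by rewrite eqe gt_eqF// mulr_gt0 ?powR_gt0 ?expR_gt0.
by rewrite N0 lebesgue_measure_itv/= lte_fin ltr01 -EFinB lee_fin subr0 ler10.
Qed.

End incomplete_gamma.

(** * Truncated moments of the density *)

Section generalized_gaussian_moments.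
Context {R : realType}.
Variables (a b : R).
Hypotheses (a_gt0 : 0 < a) (b_gt0 : 0 < b).
Notation mu := (@lebesgue_measure R).

Lemma fZ_ge0 (z : R) : 0 <= fZ a b z.
Proof.
rewrite /fZ mulr_ge0 ?expR_ge0// invr_ge0.
by rewrite !mulr_ge0 ?(ltW a_gt0) ?(ltW b_gt0)// ltW// Gamma_gt0.
Qed.

Lemma fZN (z : R) : fZ a b (- z) = fZ a b z.
Proof. by rewrite /fZ mulNr normrN. Qed.

Lemma continuous_fZ (z : R) : 0 < z -> {for z, continuous (fZ a b)}.
Proof.
move=> z0; rewrite /fZ; apply: continuousM; first exact: cst_continuous.
apply: continuous_comp; last exact: continuous_expR.
apply: continuousN.
have cn : {for z, continuous (fun z : R => `|z / b|)}.
  apply: continuous_comp; last exact: norm_continuous.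
  exact: mulrr_continuous.
have cp : {for `|z / b|, continuous (@powR R ^~ a^-1)}.
  by apply: continuous_powR; rewrite normr_gt0 mulf_neq0// ?invr_eq0 gt_eqF.
exact: (continuous_comp cn cp).
Qed.

Lemma continuous_moment_integrand (k : nat) :
  {in `]0, +oo[, continuous (fun z : R => z ^+ k * fZ a b z)}.
Proof.
move=> z; rewrite in_itv/= andbT => z0.
exact: (continuousM (@exprn_continuous R k z) (continuous_fZ _ z0)).
Qed.

Lemma fZ_power_map (t : R) : 0 < t ->
  fZ a b (power_map a b t) = (2 * a * b * Gamma a)^-1 * expR (- t).
Proof.
move=> t0; rewrite /fZ /power_map [b * _]mulrC mulfK ?gt_eqF//.
by rewrite ger0_norm ?powR_ge0// -powRrM mulfV ?gt_eqF// powRr1// ltW.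
Qed.

(** This identity explains the incomplete gamma functions of parameter
    [(k + 1) * a] in the final formulas: [t ^ (a * k)] comes from [z ^ k],
    [t ^ (a - 1)] from the Jacobian and [expR (- t)] from the density. *)
Lemma moment_integrand_power_map (k : nat) (t : R) : 0 < t ->
  power_map a b t ^+ k * fZ a b (power_map a b t) * dpower_map a b t =
  b ^+ k / (2 * Gamma a) * gamma_integrand (k.+1%:R * a) t.
Proof.
move=> t0; rewrite fZ_power_map// /power_map /dpower_map /gamma_integrand.
have -> : t `^ (k.+1%:R * a - 1) = (t `^ a) ^+ k * t `^ (a - 1).
  rewrite -powR_mulrn ?powR_ge0// -powRrM -powRD; last first.
    by rewrite (gt_eqF t0) implybT.
  by congr (_ `^ _); rewrite -natr1; ring.
rewrite exprMn; field.
by rewrite !gt_eqF ?Gamma_gt0.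
Qed.

Lemma integral_moment_tail (k : nat) (x : R) : 0 <= x ->
  (\int[mu]_(z in `]power_map a b x, +oo[) (z ^+ k * fZ a b z)%:E =
   (b ^+ k / (2 * Gamma a) * upper_gamma (k.+1%:R * a) x)%:E)%E.
Proof.
move=> x0; have p0 : 0 < k.+1%:R * a by rewrite mulr_gt0.
rewrite (@ge0_integral_power_map_tail _ a b a_gt0 b_gt0
  (fun z => z ^+ k * fZ a b z))//.
- have pos t : t \in `]x, +oo[%classic -> 0 < t.
    by rewrite inE/= in_itv/= andbT; exact: le_lt_trans.
  under eq_integral => t /pos t0 do rewrite moment_integrand_power_map// EFinM.
  have ig : mu.-integrable `]x, +oo[
      (fun t => (gamma_integrand (k.+1%:R * a) t)%:E).
    apply: integrableS (integrable_gamma_integrand _ p0) => //.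
    exact: subset_itvr.
  rewrite integralZl// [in RHS]EFinM upper_gamma_itvoy /Rintegral fineK//.
  exact: integrable_fin_num.
- exact: continuous_moment_integrand.
- by move=> z z0; rewrite mulr_ge0 ?fZ_ge0// exprn_ge0// ltW.
Qed.

Lemma integral_moment_head (k : nat) (x : R) : 0 <= x ->
  (\int[mu]_(z in `]0%R, power_map a b x]) (z ^+ k * fZ a b z)%:E =
   (b ^+ k / (2 * Gamma a) * lower_gamma (k.+1%:R * a) x)%:E)%E.
Proof.
move=> x0; have p0 : 0 < k.+1%:R * a by rewrite mulr_gt0.
rewrite (@ge0_integral_power_map_head _ a b a_gt0 b_gt0
  (fun z => z ^+ k * fZ a b z))//.
- have pos t : t \in `]0, x]%classic -> 0 < t.
    by rewrite inE/= in_itv/= => /andP[].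
  under eq_integral => t /pos t0 do rewrite moment_integrand_power_map// EFinM.
  have ig : mu.-integrable `]0%R, x]
      (fun t => (gamma_integrand (k.+1%:R * a) t)%:E).
    apply: integrableS (integrable_gamma_integrand _ p0) => //.
    exact: subset_itvl.
  rewrite integralZl// [in RHS]EFinM lower_gamma_itvoc /Rintegral fineK//.
  exact: integrable_fin_num.
- exact: continuous_moment_integrand.
- by move=> z z0; rewrite mulr_ge0 ?fZ_ge0// exprn_ge0// ltW.
Qed.

End generalized_gaussian_moments.

(** * Integration against an even density *)

Section even_density.
Context {R : realType}.
Notation mu := (@lebesgue_measure R).

(** Nonnegativity of the moment integrands makes each of them integrable as soon
    as its integral is a real number, so the integral can be split even when
    the coefficients have different signs. *)
Lemma integral_quadratic (D : set R) (f : R -> R) (M : nat -> R)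
    (p0 p1 p2 : R) : measurable D -> measurable_fun D f ->
  (forall z, D z -> 0 <= z) -> (forall z, D z -> 0 <= f z) ->
  (forall k, \int[mu]_(z in D) (z ^+ k * f z)%:E = (M k)%:E)%E ->
  (\int[mu]_(z in D) ((p0 + p1 * z + p2 * z ^+ 2) * f z)%:E =
   (p0 * M 0 + p1 * M 1 + p2 * M 2)%:E)%E.
Proof.
move=> mD mf D0 f0 fM.
have int k : mu.-integrable D (fun z : R => (z ^+ k * f z)%:E).
  apply: (ge0_integrable_EFin mu D (fun z : R => z ^+ k * f z)) (fM k).
    exact: measurable_funM.
  by move=> z Dz; rewrite mulr_ge0 ?f0// exprn_ge0// D0.
have intZ k (p : R) :
    mu.-integrable D (fun z : R => p%:E * (z ^+ k * f z)%:E)%E.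
  exact: integrableZl.
transitivity (\int[mu]_(z in D) (p0%:E * (z ^+ 0 * f z)%:E +
    p1%:E * (z ^+ 1 * f z)%:E + p2%:E * (z ^+ 2 * f z)%:E))%E.
  apply: eq_integral => z _; rewrite -!EFinM -!EFinD; congr EFin; ring.
rewrite !integralD ?integralZl ?fM//; last exact: integrableD.
Qed.

Lemma ge0_integral_even_density (h f : R -> R) :
  measurable_fun [set: R] h -> measurable_fun [set: R] f ->
  (forall z, 0 <= h z) -> (forall z, 0 <= f z) -> (forall z, f (- z) = f z) ->
  (\int[mu]_z (h z * f z)%:E =
   \int[mu]_(z in `]0%R, +oo[) ((h z + h (- z)) * f z)%:E)%E.
Proof.
move=> mh mf h0 f0 fN.
have mhf : measurable_fun [set: R] (fun z : R => (h z * f z)%:E).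
  by apply/measurable_EFinP; exact: measurable_funM.
have mhNf : measurable_fun [set: R] (fun z : R => (h (- z) * f z)%:E).
  apply/measurable_EFinP; apply: measurable_funM => //.
  by apply: measurableT_comp => //; exact: measurable_funN.
rewrite -(setUv `]0%R, +oo[%classic) ge0_integral_setU//=.
- rewrite setCitvr [X in (_ + X)%E](_ : _ =
      \int[mu]_(z in `]0%R, +oo[) (h (- z) * f z)%:E)%E.
    rewrite -ge0_integralD//.
    + by apply: eq_integral => z _; rewrite -EFinD mulrDl.
    + by move=> z _; rewrite lee_fin mulr_ge0.
    + exact: measurable_funTS.
    + by move=> z _; rewrite lee_fin mulr_ge0.
    + exact: measurable_funTS.
  rewrite integral_itv_obnd_cbnd; last exact: measurable_funTS.
  rewrite ge0_integration_by_substitution0//.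
    by apply: eq_integral => z _; rewrite opprK fN.
  by move=> z; rewrite lee_fin mulr_ge0.
- exact: measurableC.
- by rewrite setUv.
- by move=> z _; rewrite lee_fin mulr_ge0.
- exact/disj_setPCl.
Qed.

End even_density.

(** * Expectation of a piecewise quadratic function *)

Section expected_loss.
Context {R : realType} {d : measure_display} {T : measurableType d}.
Variables (P : probability T R) (Z : {RV P >-> R}) (a b c : R).
Hypotheses (a_gt0 : 0 < a) (b_gt0 : 0 < b) (hZ : has_density P Z (fZ a b)).
Notation mu := (@lebesgue_measure R).
Let x := `|c / b| `^ a^-1.

(** Only the symmetrised function [h z + h (- z)] has to be quadratic on the two
    pieces, which covers both the loss and its square. *)
Lemma integral_piecewise_quadratic (h : R -> R) (p0 p1 p2 q0 q1 q2 : R) :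
  measurable_fun [set: R] h -> (forall z : R, 0 <= h z) ->
  (forall z : R, 0 < z -> z <= `|c| ->
    h z + h (- z) = p0 + p1 * z + p2 * z ^+ 2) ->
  (forall z : R, `|c| < z ->
    h z + h (- z) = q0 + q1 * z + q2 * z ^+ 2) ->
  (\int[P]_w (h (Z w))%:E =
   ((p0 * lower_gamma a x + p1 * b * lower_gamma (2 * a) x +
     p2 * b ^+ 2 * lower_gamma (3 * a) x +
     (q0 * upper_gamma a x + q1 * b * upper_gamma (2 * a) x +
      q2 * b ^+ 2 * upper_gamma (3 * a) x)) / (2 * Gamma a))%:E)%E.
Proof.
move=> mh h0 hp hq.
have [mf f0 _] := hZ.
have x0 : 0 <= x by exact: powR_ge0.
have xE : power_map a b x = `|c|.
  rewrite /power_map /x -powRrM mulVf ?gt_eqF// powRr1//.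
  by rewrite normrM normfV (gtr0_norm b_gt0) mulrC divfK ?gt_eqF.
rewrite (ge0_integral_density h hZ)//.
rewrite (ge0_integral_even_density _ _ mh mf h0 f0 (fZN a b)).
have splitE : `]0, +oo[%classic = `]0, `|c|] `|` `]`|c|, +oo[%classic :> set R.
  by rewrite -itv_bndbnd_setU// bnd_simp.
rewrite splitE ge0_integral_setU//=.
- transitivity
    (\int[mu]_(z in `]0%R, `|c|%R])
        ((p0 + p1 * z + p2 * z ^+ 2) * fZ a b z)%:E +
     \int[mu]_(z in `]`|c|%R, +oo[)
        ((q0 + q1 * z + q2 * z ^+ 2) * fZ a b z)%:E)%E.
    congr (_ + _)%E; apply: eq_integral => z; rewrite inE/= in_itv/= ?andbT.
      by move=> /andP[z0 zc]; rewrite hp.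
    by move=> cz; rewrite hq.
  have head k := integral_moment_head a b a_gt0 b_gt0 k x x0.
  have tail k := integral_moment_tail a b a_gt0 b_gt0 k x x0.
  rewrite xE in head tail.
  rewrite (integral_quadratic _ _ _ p0 p1 p2 _ _ _ _ head)//.
  + rewrite (integral_quadratic _ _ _ q0 q1 q2 _ _ _ _ tail)//.
    * rewrite -EFinD !mul1r; congr EFin.
      have /lt0r_neq0 := Gamma_gt0 a a_gt0.
      move: (Gamma a) (lower_gamma a x) (lower_gamma (2 * a) x)
        (lower_gamma (3 * a) x) (upper_gamma a x) (upper_gamma (2 * a) x)
        (upper_gamma (3 * a) x) => g l1 l2 l3 u1 u2 u3 g0.
      by field.
    * exact: measurable_funTS.
    * by move=> z; rewrite /= in_itv/= andbT => /ltW; exact: le_trans.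
  + exact: measurable_funTS.
  + by move=> z; rewrite /= in_itv/= => /andP[/ltW].
- apply/measurable_EFinP; apply: measurable_funTS; apply: measurable_funM => //.
  apply: measurable_funD => //.
  by apply: measurableT_comp => //; exact: measurable_funN.
- by move=> z _; rewrite lee_fin mulr_ge0 ?addr_ge0.
- apply/disj_setPS => t /=; rewrite !in_itv/= !andbT => -[/andP[_ t1]].
  by rewrite ltNge t1.
Qed.

End expected_loss.

(** * The loss function *)

Section piecewise_linear_loss.
Context {R : realType}.
Variables (k1 k2 : R).
Hypotheses (k1_gt0 : 0 < k1) (k2_gt0 : 0 < k2).

Lemma L_nneg (y : R) : 0 <= y -> L k1 k2 y = k1 * y.
Proof. by rewrite /L => ->. Qed.

Lemma L_npos (y : R) : y <= 0 -> L k1 k2 y = - k2 * y.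
Proof.
rewrite /L le_eqVlt => /predU1P[->|]; first by rewrite lexx !mulr0.
by rewrite ltNge => /negbTE ->.
Qed.

Lemma L_ge0 (y : R) : 0 <= L k1 k2 y.
Proof.
have [y0|y0] := leP 0 y; first by rewrite L_nneg// mulr_ge0// ltW.
by rewrite L_npos ?mulr_le0 ?oppr_le0 ?ltW.
Qed.

Lemma measurable_L : measurable_fun [set: R] (L k1 k2).
Proof.
apply: measurable_fun_ifT; first exact: measurable_fun_ler.
- exact: measurable_funM.
- exact: measurable_funM.
Qed.

(** The zero coefficients keep the shape of a full quadratic polynomial, as
    consumed by [integral_piecewise_quadratic]. *)
Lemma L_reflect_near (c z : R) : 0 < z -> z <= `|c| ->
  L k1 k2 (z + c) + L k1 k2 (- z + c) =
    (k1 - k2) * c + (k1 + k2) * `|c| + 0 * z + 0 * z ^+ 2.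
Proof.
move=> z0; have [c0|c0] := ger0P c => zc.
  by rewrite !L_nneg; try lra; ring.
by rewrite !L_npos; try lra; ring.
Qed.

Lemma L_reflect_far (c z : R) : `|c| < z ->
  L k1 k2 (z + c) + L k1 k2 (- z + c) =
    (k1 - k2) * c + (k1 + k2) * z + 0 * z ^+ 2.
Proof.
rewrite ltr_norml => /andP[zc cz].
by rewrite L_nneg ?L_npos; try lra; ring.
Qed.

Lemma sqr_L_reflect_near (c z : R) : 0 < z -> z <= `|c| ->
  L k1 k2 (z + c) ^+ 2 + L k1 k2 (- z + c) ^+ 2 =
    (k1 ^+ 2 + k2 ^+ 2 + Sgn c * (k1 ^+ 2 - k2 ^+ 2)) * c ^+ 2 + 0 * z +
    (k1 ^+ 2 + k2 ^+ 2 + Sgn c * (k1 ^+ 2 - k2 ^+ 2)) * z ^+ 2.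
Proof.
move=> z0; rewrite /Sgn; have [c0|c0] := ger0P c => zc.
  by rewrite !L_nneg; try lra; ring.
by rewrite !L_npos; try lra; ring.
Qed.

Lemma sqr_L_reflect_far (c z : R) : `|c| < z ->
  L k1 k2 (z + c) ^+ 2 + L k1 k2 (- z + c) ^+ 2 =
    (k1 ^+ 2 + k2 ^+ 2) * c ^+ 2 + 2 * (k1 ^+ 2 - k2 ^+ 2) * c * z +
    (k1 ^+ 2 + k2 ^+ 2) * z ^+ 2.
Proof.
rewrite ltr_norml => /andP[zc cz].
by rewrite L_nneg ?L_npos; try lra; ring.
Qed.

End piecewise_linear_loss.

(** * Mean and variance of the loss *)

Theorem lemma1 (R : realType) (a b k1 k2 : R)
    (ha : 0 < a) (hb : 0 < b) (hk1 : 0 < k1) (hk2 : 0 < k2)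
    (d : measure_display) (T : measurableType d) (P : probability T R)
    (Z : {RV P >-> R}) (hZ : has_density P Z (fZ a b)) (c : R) :
  let x := `|c / b| `^ (a^-1) in
  ('E_P[fun w => L k1 k2 (Z w + c)] =
     ((k1 - k2) * c / 2
      + (k1 + k2) * `|c| / (2 * Gamma a) * lower_gamma a x
      + (k1 + k2) * b / (2 * Gamma a) * upper_gamma (2 * a) x)%:E)%E
  /\
  ('V_P[fun w => L k1 k2 (Z w + c)] =
     ((k1 + k2) ^+ 2 * c ^+ 2 / 4
      + (k1 ^+ 2 - k2 ^+ 2) * b * c / (2 * Gamma a) * upper_gamma (2 * a) x
      - (k1 + k2) ^+ 2 * b * `|c| / (2 * Gamma a ^+ 2)
        * lower_gamma a x * upper_gamma (2 * a) x
      - (k1 + k2) ^+ 2 * c ^+ 2 / (4 * Gamma a ^+ 2) * lower_gamma a x ^+ 2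
      - (k1 + k2) ^+ 2 * b ^+ 2 / (4 * Gamma a ^+ 2)
        * upper_gamma (2 * a) x ^+ 2
      + (k1 ^+ 2 + k2 ^+ 2) * b ^+ 2 * Gamma (3 * a) / (2 * Gamma a)
      + Sgn c * ((k1 ^+ 2 - k2 ^+ 2) * b ^+ 2 / (2 * Gamma a))
        * lower_gamma (3 * a) x)%:E)%E.
Proof.
move=> x.
have x0 : 0 <= x by exact: powR_ge0.
have mL : measurable_fun [set: R] (fun z => L k1 k2 (z + c)).
  by apply: measurableT_comp; [exact: measurable_L|exact: measurable_funD].
have EL := integral_piecewise_quadratic P Z a b c ha hb hZ _ _ _ _ _ _ _ mL
  (fun z => L_ge0 k1 k2 hk1 hk2 (z + c))
  (L_reflect_near k1 k2 c) (L_reflect_far k1 k2 c).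
have EL2 := integral_piecewise_quadratic P Z a b c ha hb hZ _ _ _ _ _ _ _
  (measurable_funX 2 mL) (fun z => sqr_ge0 (L k1 k2 (z + c)))
  (sqr_L_reflect_near k1 k2 c) (sqr_L_reflect_far k1 k2 c).
have G0 : Gamma a != 0 by rewrite gt_eqF// Gamma_gt0.
have Ua := upper_gammaE a x ha x0.
have U3a : upper_gamma (3 * a) x = Gamma (3 * a) - lower_gamma (3 * a) x.
  by apply: upper_gammaE => //; exact: mulr_gt0.
rewrite -/x in EL EL2.
set X := (fun w => L k1 k2 (Z w + c)).
have EX : ('E_P[X] = ((k1 - k2) * c / 2
      + (k1 + k2) * `|c| / (2 * Gamma a) * lower_gamma a x
      + (k1 + k2) * b / (2 * Gamma a) * upper_gamma (2 * a) x)%:E)%E.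
  rewrite unlock EL; congr EFin.
  rewrite Ua; move: (Gamma a) (lower_gamma a x) (upper_gamma (2 * a) x) G0.
  by move=> g l1 u2 g0; field.
split; first by [].
have mX : measurable_fun [set: T] X.
  exact: (measurableT_comp mL (measurable_funPT Z)).
have L1X : X \in Lfun P 1.
  apply/Lfun1_integrable; apply: (ge0_integrable_EFin _ _ _ _ mX _ EL) => w _.
  exact: L_ge0.
have L1X2 : (X * X)%R \in Lfun P 1.
  apply/Lfun1_integrable.
  apply: (ge0_integrable_EFin _ _ (X * X) _ (measurable_funM mX mX) _ EL2).
  by move=> w _; exact: sqr_ge0.
rewrite [LHS](covarianceE L1X L1X L1X2) EX.
have -> : ('E_P[(X * X)%R] = \int[P]_w (L k1 k2 (Z w + c) ^+ 2)%:E)%E.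
  by rewrite unlock.
rewrite EL2 -EFinM -EFinB; congr EFin.
rewrite Ua U3a /Sgn.
move: (Gamma a) (lower_gamma a x) (upper_gamma (2 * a) x)
  (Gamma (3 * a)) (lower_gamma (3 * a) x) G0 => g l1 u2 g3 l3 g0.
(* Besides removing [`|c|] and [Sgn c], the case split exhibits [c * `|c|] as
   [Sgn c * c ^ 2]: this is how the terms in [lower_gamma a x] that are linear
   in [k1 ^ 2 - k2 ^ 2] cancel between the second moment and the square of the
   mean. *)
by have [c0|c0] := ger0P c; field.
Qed.
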